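(* Let $a>0$ and $c\in\mathbb{R}$. (1) For $0<x<y$, the inequality $$\frac{(\Gamma(x+a))^{1/x}}{(\Gamma(y+a))^{1/y}}>\left(\frac xy\right)^c$$ holds if $c\ge 1$ and either $\frac12\le a\le 1$ or $a\ge 2$; and the reversed inequality (with $<$) holds if $c\le 0$ and either $a=1$ or $a=2$. (2) For $x,y>0$, the inequality $$\frac{\left(\Gamma\left(\frac{x+y}{2}+a\right)\right)^{\frac{2}{x+y}}}{\sqrt{(\Gamma(x+a))^{1/x}(\Gamma(y+a))^{1/y}}}\le\left(\frac{x+y}{2\sqrt{xy}}\right)^c$$ holds if $a\ge 2$ and $c\ge 1$; and the reversed inequality (with $\ge$) holds if $a=2$ and $c\le 0$. In each case equality holds if and only if $x=y$. (3) For $x,y>0$, the inequalities $$\left(\frac xy\right)^{\frac{y\psi(y+a)-\log\Gamma(y+a)}{y}}\le\frac{(\Gamma(x+a))^{1/x}}{(\Gamma(y+a))^{1/y}}\le\left(\frac xy\right)^{\frac{x\psi(x+a)-\log\Gamma(x+a)}{x}}$$ hold if $\frac12\le a\le 1$ or $a\ge 2$ (and $c\in\mathbb{R}$ arbitrary). In each of these inequalities, equality holds if and only if $x=y$.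
   Context: $\Gamma$ is the gamma function on $(0,\infty)$ and $\psi=\Gamma'/\Gamma$ is the digamma function. *)

(* Defs.v *)
From HB Require Import structures.
From mathcomp Require Import all_boot all_order all_algebra.
From mathcomp Require Import all_classical all_reals all_analysis.

Set Implicit Arguments.
Unset Strict Implicit.
Unset Printing Implicit Defensive.

Import Order.TTheory GRing.Theory Num.Theory.
Import numFieldNormedType.Exports.

Local Open Scope classical_set_scope.
Local Open Scope ring_scope.

(* Both functions are meaningful only for x > 0: for x <= 0 the Lebesgue
   integral diverges and [Rintegral] returns 0. *)
Definition Gamma (R : realType) (x : R) : R :=
  \int[lebesgue_measure]_(t in `]0%R, +oo[) (t `^ (x - 1) * expR (- t)).

Definition digamma (R : realType) (x : R) : R :=
  derive1 (@Gamma R) x / Gamma x.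

(* Main.v *)
Require Import Defs.
From HB Require Import structures.
From mathcomp Require Import all_boot all_order all_algebra.
From mathcomp Require Import all_classical all_reals all_analysis.
From mathcomp Require Import measurable_realfun.
From mathcomp Require Import ring lra.
Import Order.TTheory GRing.Theory Num.Theory.
Import numFieldNormedType.Exports.
Local Open Scope ring_scope.

(** Taking logarithms turns every claim into a statement about
    h(x) = ln Gamma(x + a) / x.  With
    w(x) = x digamma(x + a) - ln Gamma(x + a) one has h' = w / x^2, so that
    x h'(x) = w(x) / x is the derivative of h with respect to ln x.

    The right-hand sides are monotone in c, so c = 1 and c = 0 decide.

    - Claim (1) for c = 1 says that h - ln decreases, that is w(x) < x; for
      c = 0 it says that h increases, that is w > 0.
    - Claim (2) for c = 1 says that h - ln is strictly midpoint convex, which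
      holds if x^2 trigamma(x + a) - 2 w(x) + x > 0; for c = 0 it says that h
      is strictly midpoint concave, which holds if
      x^2 trigamma(x + a) - 2 w(x) < 0.
    - Claim (3) compares the chord of h, seen as a function of ln x, with its
      tangents; it holds if w(x) / x increases, that is if
      x^2 trigamma(x + a) - w(x) > 0.

    Since w'(x) = x trigamma(x + a) and w(0) = - ln Gamma(a), each of these
    expressions has a known sign at 0 and a derivative that is elementary in
    trigamma and tetragamma = trigamma'.  The sign at 0 is that of
    ln Gamma(a), which is nonnegative off ]1, 2[ because ln Gamma is convex
    and vanishes at 1 and 2; for a = 1 or a = 2 it is zero, which is what the
    claims for c <= 0 require.  The derivatives have a sign as soon as
    a >= 1/2, by the inequalities, with z = x + a,
      trigamma z < 1 / (z - 1/2),
      tetragamma z > - 1 / (z - 1/2)^2,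
      trigamma z + (z - 1/2) tetragamma z > 0.
    Each of them says D(z) > 0 for a function D that tends to 0 along z + n,
    and it follows from D(z + 1) < D(z) ([gt0_of_shift_decr]), which the
    recurrences of trigamma and tetragamma make a rational inequality.

    The derivatives of ln Gamma come from Gauss's limit
      ln Gamma x = lim_n (ln Gamma n + x ln n - sum_(k < n) ln (x + k)),
    which the Bohr-Mollerup argument derives from the functional equation and
    from Gamma (z + s) <= z^s Gamma z for 0 <= s <= 1.  The approximants have
    locally uniformly bounded second derivatives, as have their successive
    derivatives, and this alone allows differentiating the limit
    ([cvg_deriv_of_bounded_deriv2]): no uniform convergence of the derivatives
    has to be established beforehand. *)

Local Open Scope classical_set_scope.

(** * The Gamma integral *)

(** The bound 1/t is what makes the boundary term at infinity vanish; the
    constant is the maximum of t^(x+1) exp(-t), attained at t = x + 1, and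
    the proof is the tangent inequality ln u <= u - 1 at u = t / (x + 1). *)
Lemma powR_expRN_le (R : realType) (x t : R) : 0 < x -> 0 < t ->
  t `^ x * expR (- t) <= expR ((x + 1) * ln (x + 1) - (x + 1)) * t^-1.
Proof.
move=> x0 t0; have x1 : 0 < x + 1 by lra.
have := @le_ln1Dx R (t / (x + 1) - 1).
have -> : 1 + (t / (x + 1) - 1) = t / (x + 1) by ring.
rewrite ln_div ?posrE// => /(_ _)/wrap[]; first by rewrite ltrBrDl subrr divr_gt0.
move=> lnle; rewrite ler_pdivlMr// -[X in _ * X]lnK ?posrE//.
rewrite /powR gt_eqF// -!expRD ler_expR.
have : (x + 1) * (ln t - ln (x + 1)) <= (x + 1) * (t / (x + 1) - 1).
  by rewrite ler_pM2l.
have -> : (x + 1) * (t / (x + 1) - 1) = t - (x + 1).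
  by field; rewrite gt_eqF.
lra.
Qed.

Lemma cvg_invSS (R : realType) : (n.+2%:R : R)^-1 @[n --> \oo] --> (0 : R).
Proof.
have := @cvg_harmonic R; rewrite -cvg_shiftS; exact.
Qed.

Lemma powR_expRN_cvgy (R : realType) (x : R) : 0 < x ->
  (n.+2%:R : R) `^ x * expR (- n.+2%:R) @[n --> \oo] --> (0 : R).
Proof.
move=> x0.
apply: (@squeeze_cvgr _ _ _ _ (fun=> 0)
  (fun n => expR ((x + 1) * ln (x + 1) - (x + 1)) * n.+2%:R^-1)).
- apply: nearW => n; rewrite powR_expRN_le// andbT.
  by rewrite mulr_ge0 ?powR_ge0 ?expR_ge0.
- exact: cvg_cst.
- rewrite -[X in _ --> X](mulr0 (expR ((x + 1) * ln (x + 1) - (x + 1)))).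
  by apply: cvgMr; exact: cvg_invSS.
Qed.

Lemma powR_expRN_cvg0 (R : realType) (x : R) : 0 < x ->
  (n.+2%:R^-1 : R) `^ x * expR (- n.+2%:R^-1) @[n --> \oo] --> (0 : R).
Proof.
move=> x0.
apply: (@squeeze_cvgr _ _ _ _ (fun=> 0) (fun n => (n.+2%:R^-1 : R) `^ x)).
- apply: nearW => n; rewrite mulr_ge0 ?powR_ge0 ?expR_ge0//=.
  by rewrite ler_piMr ?powR_ge0// expR_le1 oppr_le0.
- exact: cvg_cst.
- have /cvg_at_rightP := @powR_cvg0 R x x0.
  by apply; split => //; exact: cvg_invSS.
Qed.

Lemma measurable_gamma_integrand (R : realType) (D : set R) (x : R) :
  measurable_fun D (fun t : R => t `^ x * expR (- t)).
Proof.
apply: measurable_funM.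
  by apply: measurable_funTS; exact: measurable_powR.
by apply: measurableT_comp => //; exact: measurable_funN.
Qed.

Lemma is_derive_oppr_expRN (R : realType) (t : R) :
  is_derive t 1 (fun t => - expR (- t)) (expR (- t)).
Proof.
have -> : (fun t => - expR (- t)) = (- (expR \o -%R)) :> (R -> R) by [].
by apply: is_derive_eq; rewrite mulrN1 opprK.
Qed.

(** Integration by parts is applied away from the possible singularity at 0;
    the boundary terms are removed in the limit. *)
Lemma gamma_by_parts (R : realType) (x a b : R) : 0 < x -> 0 < a -> a < b ->
  (\int[lebesgue_measure]_(t in `[a, b]) (t `^ x * expR (- t))%:E =
   (a `^ x * expR (- a) - b `^ x * expR (- b))%:E +
   \int[lebesgue_measure]_(t in `[a, b]) (x * (t `^ (x - 1) * expR (- t)))%:E)%E.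
Proof.
move=> x0 a0 ab.
have derexp := @is_derive_oppr_expRN R.
have cexp (t : R) : {for t, continuous (fun t => - expR (- t))}.
  by apply: differentiable_continuous; apply/derivable1_diffP; have [] := derexp t.
have cpow (y t : R) : 0 < t -> {for t, continuous (fun t => t `^ y)}.
  move=> t0; apply: differentiable_continuous; apply/derivable1_diffP.
  by apply: derivable_powR; rewrite in_itv/= t0.
have b0 : 0 < b by lra.
rewrite (@integration_by_parts R (fun t => t `^ x) (fun t => - expR (- t))
  (fun t => x * t `^ (x - 1)) (fun t => expR (- t))) //.
- rewrite (_ : (\int[lebesgue_measure]_(t in `[a, b]) (x * t `^ (x - 1) * - expR (- t))%:E)%E =
    (- \int[lebesgue_measure]_(t in `[a, b]) (x * (t `^ (x - 1) * expR (- t)))%:E)%E);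
    last first.
    rewrite -integral_ge0N; last first.
      by move=> t _; rewrite lee_fin !mulr_ge0 ?expR_ge0 ?powR_ge0 ?ltW.
    by apply: eq_integral => t _; rewrite mulrN mulrA EFinN.
  by rewrite oppeK; congr (_%:E + _)%E; ring.
- apply: continuous_in_subspaceT => t; rewrite inE/= in_itv/= => /andP[at' _].
  by apply: cvgM; [exact: cvg_cst | apply: cpow; lra].
- split.
  + move=> t; rewrite in_itv/= => /andP[at' _].
    by apply: derivable_powR; rewrite in_itv/= andbT; lra.
  + by apply: cvg_at_right_filter; exact: cpow.
  + by apply: cvg_at_left_filter; exact: cpow.
- move=> t; rewrite in_itv/= => /andP[at' _].
  by rewrite powR_derive1// in_itv/= andbT; lra.
- apply: continuous_subspaceT => t.
  apply: differentiable_continuous; apply/derivable1_diffP.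
  have : is_derive t 1 (expR \o -%R) (- expR (- t)).
    by apply: is_derive_eq; rewrite mulrN1.
  by case.
- split.
  + by move=> t _; have [] := derexp t.
  + by apply: cvg_at_right_filter; exact: cexp.
  + by apply: cvg_at_left_filter; exact: cexp.
- by move=> t _; rewrite derive1E; have [_ ->] := derexp t.
Qed.

(** The segments start at n = 2 so that none of them is reduced to a point,
    as integration by parts requires. *)
Lemma cvg_segments (R : realType) (f : R -> R) :
  (forall t, 0 <= f t) -> measurable_fun setT f ->
  (\int[lebesgue_measure]_(t in `[(n.+2%:R^-1)%R, n.+2%:R%R]) (f t)%:E)%E @[n --> \oo]
    --> (\int[lebesgue_measure]_(t in `]0%R, +oo[) (f t)%:E)%E.
Proof.
move=> f0 mf.
have -> : (`]0, +oo[ : set R)%classic = \bigcup_n `[n.+2%:R^-1, n.+2%:R].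
  apply/seteqP; split => t /=.
    rewrite in_itv/= andbT => t0.
    have [N tN] : exists n : nat, t < n%:R by exists (Num.truncn t).+1; apply: truncnS_gt.
    have [M tM] : exists n : nat, t^-1 < n%:R by exists (Num.truncn t^-1).+1; apply: truncnS_gt.
    exists (maxn N M) => //=; rewrite in_itv/=; apply/andP; split.
      rewrite invf_ple ?posrE// (le_trans (ltW tM))// ler_nat.
      by rewrite (leq_trans (leq_maxr N M))// -addn2 leq_addr.
    rewrite (le_trans (ltW tN))// ler_nat.
    by rewrite (leq_trans (leq_maxl N M))// -addn2 leq_addr.
  by move=> [n _]; rewrite /= !in_itv/= andbT => /andP[+ _]; apply: lt_le_trans.
apply: ge0_nondecreasing_set_cvg_integral => //.
- move=> n m nm; apply/subsetPset; apply: subset_itv; rewrite bnd_simp.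
    by rewrite lef_pV2 ?posrE// ler_nat !ltnS.
  by rewrite ler_nat !ltnS.
- by move=> i; apply/measurable_EFinP; exact: measurable_funTS.
- by move=> i t _; rewrite lee_fin.
Qed.

(** The recurrence is obtained in the extended reals, where monotone
    convergence needs no finiteness; finiteness of the integral is then
    deduced from it. *)
Lemma ereal_GammaS (R : realType) (x : R) : 0 < x ->
  (\int[lebesgue_measure]_(t in `]0%R, +oo[) (t `^ x * expR (- t))%:E =
   x%:E * \int[lebesgue_measure]_(t in `]0%R, +oo[) (t `^ (x - 1) * expR (- t))%:E)%E.
Proof.
move=> x0.
have nn (y t : R) : 0 <= t `^ y * expR (- t) by rewrite mulr_ge0 ?powR_ge0 ?expR_ge0.
rewrite -ge0_integralZl_EFin//; last 2 first.
- by apply/measurable_EFinP; exact: measurable_gamma_integrand.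
- exact: ltW.
under [in RHS]eq_integral do rewrite -EFinM.
have cA := @cvg_segments R (fun t => t `^ x * expR (- t)) (nn x)
  (@measurable_gamma_integrand R setT x).
have cB : _ := @cvg_segments R (fun t => x * (t `^ (x - 1) * expR (- t))) _ _.
have {}cB := cB (fun t => mulr_ge0 (ltW x0) (nn (x - 1) t))
  (measurable_funM (measurable_cst _) (@measurable_gamma_integrand R setT (x - 1))).
have K0 : ((n.+2%:R^-1 `^ x * expR (- n.+2%:R^-1) -
    n.+2%:R `^ x * expR (- n.+2%:R))%:E @[n --> \oo] --> (0 : R)%:E)%E.
  apply: cvg_EFin; first exact: nearW.
  rewrite -[X in _ --> X](subr0 (0:R)); apply: cvgB; first exact: powR_expRN_cvg0.
  exact: powR_expRN_cvgy.
have := cvgeD _ K0 cB; rewrite add0e => /(_ _ isT) cKB.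
have eK n := @gamma_by_parts R x n.+2%:R^-1 n.+2%:R x0.
apply: (cvg_unique _ cA) => //; apply: cvg_trans cKB.
apply: near_eq_cvg; apply: nearW => n; rewrite /= eK//.
- by rewrite (@lt_trans _ _ 1)// ?invf_lt1// ltr1n.
- by move=> t _; rewrite lee_fin.
Qed.

Lemma integral_exp_itv (R : realType) :
  (\int[lebesgue_measure]_(t in `]0%R, +oo[) (expR (- t))%:E = 1 :> \bar R)%E.
Proof.
have derexp := @is_derive_oppr_expRN R.
have cexp : continuous (fun t : R => expR (- t)).
  move=> t; apply: (@continuous_comp _ _ _ -%R expR); first exact: opp_continuous.
  exact: continuous_expR.
rewrite integral_itv_obnd_cbnd; last first.
  by apply/measurable_EFinP; apply: measurableT_comp => //; exact: measurable_funN.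
rewrite (@ge0_continuous_FTC2y R (fun t => expR (- t)) (fun t => - expR (- t)) 0 0).
- by rewrite oppr0 expR0 -EFinB opprK add0r.
- by move=> t _; exact: expR_ge0.
- exact: continuous_subspaceT.
- rewrite -[X in _ --> X]oppr0; apply: cvgN; exact: cvgr_expR.
- by move=> t _; have [] := derexp t.
- apply: cvg_at_right_filter; apply: cvgN; exact: cexp.
- by move=> t _; rewrite derive1E; have [_ ->] := derexp t.
Qed.

(** At positive integers the recurrence gives a finite value; between
    integers t^(y-1) <= 1 + t^n; and for 0 < x < 1 the recurrence transports
    finiteness from x + 1 back to x, so that the singularity of the integrand
    at 0 is never estimated. *)
Lemma ereal_Gamma_lty (R : realType) (x : R) : 0 < x ->
  (\int[lebesgue_measure]_(t in `]0%R, +oo[) (t `^ (x - 1) * expR (- t))%:E < +oo)%E.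
Proof.
pose I (y : R) := (\int[lebesgue_measure]_(t in `]0%R, +oo[) (t `^ (y - 1) * expR (- t))%:E)%E.
have nn (y t : R) : 0 <= t `^ y * expR (- t) by rewrite mulr_ge0 ?powR_ge0 ?expR_ge0.
have Irec (y : R) : 0 < y -> (I (y + 1)%R = y%:E * I y)%E.
  by move=> y0; rewrite /I addrK ereal_GammaS.
have Inat n : (I n.+1%:R < +oo)%E.
  elim: n => [|n IH].
    rewrite /I subrr; under eq_integral do rewrite powRr0 mul1r.
    by rewrite integral_exp_itv ltry.
  by rewrite -natr1 Irec// lte_mul_pinfty.
have Ige1 (y : R) : 1 <= y -> (I y < +oo)%E.
  move=> y1; pose n := (Num.truncn y).+1.
  have yn : y - 1 <= n%:R by have /ltW := truncnS_gt y; rewrite -/n; lra.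
  apply: (@le_lt_trans _ _ (I 1%R + I n.+1%:R%R)%E); last first.
    by rewrite lte_add_pinfty// (Inat 0%N).
  rewrite /I -ge0_integralD//; last 4 first.
  - by move=> t _; rewrite lee_fin.
  - by apply/measurable_EFinP; exact: measurable_gamma_integrand.
  - by move=> t _; rewrite lee_fin.
  - by apply/measurable_EFinP; exact: measurable_gamma_integrand.
  apply: ge0_le_integral => //.
  - by move=> t _; rewrite lee_fin.
  - by apply/measurable_EFinP; exact: measurable_gamma_integrand.
  - apply/measurable_EFinP; apply: measurable_funD; exact: measurable_gamma_integrand.
  move=> t; rewrite /= in_itv/= andbT => t0.
  rewrite -EFinD lee_fin -mulrDl ler_wpM2r ?expR_ge0// subrr powRr0 -natr1 addrK.
  have [t1|t1] := leP 1 t.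
    by rewrite ler_wpDl// ler_powR.
  rewrite ler_wpDr ?powR_ge0//.
  by rewrite -[X in _ <= X](powRr0 t) ger_powR ?t0 ?(ltW t1)//; lra.
move=> x0; have := Ige1 (x + 1); rewrite Irec// -/(I x) => /(_ _)/wrap[]; first by lra.
rewrite ltNge => /negP h; rewrite ltNge; apply/negP; rewrite leye_eq => /eqP E.
by apply: h; rewrite E gt0_muley ?lexx// lte_fin.
Qed.

Lemma integrable_gamma (R : realType) (x : R) : 0 < x ->
  lebesgue_measure.-integrable `]0, +oo[ (EFin \o (fun t : R => t `^ (x - 1) * expR (- t))).
Proof.
move=> x0; apply/integrableP; split.
  by apply/measurable_EFinP; exact: measurable_gamma_integrand.
under eq_integral do rewrite /= ger0_norm ?mulr_ge0 ?powR_ge0 ?expR_ge0//.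
exact: ereal_Gamma_lty.
Qed.

Lemma GammaS (R : realType) (x : R) : 0 < x -> Gamma (x + 1) = x * Gamma x.
Proof.
move=> x0; rewrite /Gamma /Rintegral addrK ereal_GammaS// fineM//.
by apply: integrable_fin_num => //; exact: integrable_gamma.
Qed.

Lemma Gamma1 (R : realType) : Gamma (1 : R) = 1.
Proof.
rewrite /Gamma /Rintegral subrr; under eq_integral do rewrite powRr0 mul1r.
by rewrite integral_exp_itv.
Qed.

Lemma gt0_powRD (R : realType) (t r s : R) : 0 < t -> t `^ (r + s) = t `^ r * t `^ s.
Proof. by move=> t0; rewrite powRD// (gt_eqF t0) implybT. Qed.

Lemma gt0_powRB1 (R : realType) (t r : R) : 0 < t -> t `^ (r - 1) = t `^ r / t.
Proof. by move=> t0; rewrite powRB ?(gt_eqF t0) ?implybT// powRr1 ?ltW. Qed.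

(** Concavity of t^s for 0 <= s <= 1, as the position of its graph below the
    tangent at z. *)
Lemma powR_tangent (R : realType) (s t z : R) : 0 <= s <= 1 -> 0 < t -> 0 < z ->
  t `^ s <= s * z `^ (s - 1) * t + (1 - s) * z `^ s.
Proof.
move=> /andP[s0 s1] t0 z0.
have -> : s * z `^ (s - 1) * t + (1 - s) * z `^ s = z `^ s * (s * (t / z) + (1 - s)).
  by rewrite gt0_powRB1//; field; rewrite gt_eqF.
have q0 : 0 < t / z by rewrite divr_gt0.
have -> : t `^ s = z `^ s * (t / z) `^ s.
  rewrite -powRM ?ltW//; congr (_ `^ _); field; by rewrite gt_eqF.
rewrite ler_wpM2l ?powR_ge0//.
rewrite /powR gt_eqF//; set q := ln (t / z).
have -> : t / z = expR q by rewrite lnK.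
have := expR_ge1Dx ((1 - s) * q); have := expR_ge1Dx (- (s * q)) => e1 e2.
(* after division by expR (s * q) the weights s and 1 - s cancel the linear
   terms of the two bounds 1 + u <= expR u *)
have -> : s * expR q + (1 - s) =
  expR (s * q) * (s * expR ((1 - s) * q) + (1 - s) * expR (- (s * q))).
  rewrite mulrDr !(mulrCA (expR _)) -!expRD subrr expR0 mulr1.
  by congr (_ * expR _ + _); ring.
rewrite ler_peMr ?expR_ge0//.
have : s * (1 + (1 - s) * q) <= s * expR ((1 - s) * q) by rewrite ler_wpM2l.
have : (1 - s) * (1 - s * q) <= (1 - s) * expR (- (s * q)).
  by rewrite ler_wpM2l// subr_ge0.
nra.
Qed.

Lemma Gamma_ge0 (R : realType) (x : R) : 0 <= Gamma x.
Proof. by apply: Rintegral_ge0 => t _; rewrite mulr_ge0 ?powR_ge0 ?expR_ge0. Qed.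

(** Wendel's inequality.  Integrating the tangent bound at the point z against
    t^(z-1) exp(-t) gives s z^(s-1) Gamma(z+1) + (1-s) z^s Gamma(z), which the
    functional equation collapses. It replaces logarithmic convexity. *)
Lemma Gamma_le (R : realType) (z s : R) : 0 < z -> 0 <= s <= 1 ->
  Gamma (z + s) <= z `^ s * Gamma z.
Proof.
move=> z0 s01; have /andP[s0 s1] := s01.
have -> : z `^ s * Gamma z =
    s * z `^ (s - 1) * Gamma (z + 1) + (1 - s) * z `^ s * Gamma z.
  rewrite GammaS// gt0_powRB1//.
  by field; rewrite gt_eqF.
have z10 : 0 < z + 1 by lra.
have zs0 : 0 < z + s by lra.
pose f (y : R) := fun t : R => t `^ (y - 1) * expR (- t).
have fi (y : R) : 0 < y -> lebesgue_measure.-integrable `]0, +oo[ (EFin \o f y).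
  exact: integrable_gamma.
have kfi (k y : R) : 0 < y ->
    lebesgue_measure.-integrable `]0, +oo[ (EFin \o (fun t => k * f y t)).
  by move=> y0; apply: (integrableZl _ k (fi y y0)).
rewrite -[Gamma (z + s)]/(\int[lebesgue_measure]_(t in `]0, +oo[) f (z + s) t).
rewrite -[Gamma (z + 1)]/(\int[lebesgue_measure]_(t in `]0, +oo[) f (z + 1) t).
rewrite -[Gamma z]/(\int[lebesgue_measure]_(t in `]0, +oo[) f z t).
rewrite -(RintegralZl _ _ (fi _ z10))// -(RintegralZl _ _ (fi _ z0))//.
rewrite -(RintegralD _ (kfi _ _ z10) (kfi _ _ z0))//.
apply: le_Rintegral => //.
- exact: fi.
- by apply: (integrableD _ (kfi _ _ z10) (kfi _ _ z0)).
- move=> t; rewrite /= in_itv/= andbT => t0; rewrite /f.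
  have -> : z + s - 1 = s + (z - 1) by ring.
  have -> : z + 1 - 1 = 1 + (z - 1) by ring.
  rewrite (gt0_powRD _ _ s)// (gt0_powRD _ _ 1)// (powRr1 (ltW t0)).
  have := @powR_tangent R s t z s01 t0 z0.
  set A := t `^ s; set B := z `^ (s - 1); set C := z `^ s; set D := t `^ _.
  set E := expR _ => le.
  rewrite [leRHS](_ : _ = (s * B * t + (1 - s) * C) * (D * E)); last by ring.
  by rewrite -mulrA ler_wpM2r// mulr_ge0 ?powR_ge0 ?expR_ge0.
Qed.

Lemma Gamma_nat_gt0 (R : realType) (n : nat) : 0 < Gamma (n.+1%:R : R).
Proof.
elim: n => [|n IH]; first by rewrite Gamma1.
by rewrite -natr1 GammaS// mulr_gt0.
Qed.

(** Wendel's inequality bounds Gamma at the next integer by a multiple of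
    Gamma x, so a zero at x would propagate to an integer. *)
Lemma Gamma_gt0 (R : realType) (x : R) : 0 < x -> 0 < Gamma x.
Proof.
move=> x0; have /andP[nx xn] := truncn_itv (ltW x0).
set n := Num.truncn x in nx xn.
have := @Gamma_le R x (n.+1%:R - x) x0.
rewrite addrCA subrr addr0 => /(_ _)/wrap[].
  by rewrite subr_ge0 (ltW xn)/= -natr1; lra.
move=> h; rewrite lt0r Gamma_ge0 andbT; apply/eqP => e.
by move: h; rewrite e mulr0 leNgt Gamma_nat_gt0.
Qed.

(** * Differentiating pointwise limits *)

Section positive_half_line.
Context {R : realType}.
Implicit Types (f df g : R -> R) (x y t d : R).

Lemma MVT_pos f df x y : (forall t, 0 < t -> is_derive t 1 f (df t)) ->
  0 < x -> x < y -> exists2 c, x < c < y & f y - f x = df c * (y - x).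
Proof.
move=> fdf x0 xy.
have [t||c] := @MVT R f df x y xy.
- by rewrite in_itv/= => /andP[xt _]; apply: fdf; rewrite (lt_trans x0).
- apply: derivable_within_continuous => t; rewrite in_itv/= => /andP[xt _].
  by have [] := fdf t (lt_le_trans x0 xt).
by rewrite in_itv/= => cxy e; exists c.
Qed.

(** The derivative is only bounded up to distance |y - x| from x; this locality
    is what yields the quadratic remainder in the next lemma. *)
Lemma le_increment f df x y (d M : R) :
  (forall t, 0 < t -> is_derive t 1 f (df t)) -> 0 < d -> d <= x -> d <= y ->
  (forall t, d <= t -> `|t - x| <= `|y - x| -> `|df t| <= M) ->
  `|f y - f x| <= M * `|y - x|.
Proof.
move=> fdf d0 dx dy dfM.
have [xy|yx|->] := ltrgtP y x; last by rewrite !subrr normr0 ?mulr0.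
- have [c /andP[yc cx] e] := @MVT_pos f df y x fdf (lt_le_trans d0 dy) xy.
  rewrite distrC e normrM (@gtr0_norm _ (x - y)) ?subr_gt0// ler_pM2r ?subr_gt0//.
  by apply: dfM; first lra; rewrite !ltr0_norm; lra.
- have [c /andP[yc cx] ->] := @MVT_pos f df x y fdf (lt_le_trans d0 dx) yx.
  rewrite normrM (@gtr0_norm _ (y - x)) ?subr_gt0// ler_pM2r ?subr_gt0//.
  by apply: dfM; first lra; rewrite !gtr0_norm; lra.
Qed.

Lemma taylor1_le f df ddf x y (d M : R) :
  (forall t, 0 < t -> is_derive t 1 f (df t)) ->
  (forall t, 0 < t -> is_derive t 1 df (ddf t)) ->
  (forall t, d <= t -> `|ddf t| <= M) ->
  0 < d -> d <= x -> d <= y ->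
  `|f y - f x - (y - x) * df x| <= M * (y - x) ^+ 2.
Proof.
move=> fdf dfddf ddfM d0 dx dy.
have M0 : 0 <= M := le_trans (normr_ge0 _) (ddfM d (lexx d)).
pose g t := f t - t * df x.
have gdg t : 0 < t -> is_derive t 1 g (df t - df x).
  move=> t0; have fd := fdf t t0.
  have -> : g = f - (fun t => t * df x) by [].
  have ld : is_derive t 1 (fun t => t * df x) (df x).
    have -> : (fun t => t * df x) = (df x \*: id).
      by apply/funext => s; rewrite /= mulrC.
    by apply: is_derive_eq; rewrite scaler1.
  by apply: is_deriveB.
have -> : f y - f x - (y - x) * df x = g y - g x by rewrite /g; ring.
have -> : M * (y - x) ^+ 2 = M * `|y - x| * `|y - x|.
  by rewrite -mulrA -normrM -expr2 ger0_norm// sqr_ge0.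
apply: (@le_increment g _ x y d _ gdg) => // t dt tx.
apply: (le_trans (@le_increment df ddf x t d M dfddf d0 dx dt _)).
  by move=> s ds _; exact: ddfM.
by rewrite ler_wpM2l.
Qed.

(** A bound M on the second derivatives makes the difference quotient of F n
    with step h differ from G n x by at most M h, uniformly in n.  As the
    quotients converge when n tends to infinity, G n x is a Cauchy sequence,
    and its limit is within M h of the quotient of f. *)
Lemma cvg_deriv_of_bounded_deriv2 (F G H : nat -> R -> R) f :
  (forall n t, 0 < t -> is_derive t 1 (F n) (G n t)) ->
  (forall n t, 0 < t -> is_derive t 1 (G n) (H n t)) ->
  (forall d : R, 0 < d -> exists M, forall n t, d <= t -> `|H n t| <= M) ->
  (forall t, 0 < t -> F n t @[n --> \oo] --> f t) ->
  forall x, 0 < x -> is_derive x 1 f (f^`()%classic x) /\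
    (G n x @[n --> \oo] --> f^`()%classic x).
Proof.
move=> FG GH Hbnd Ff x x0.
have d0 : 0 < x / 2 by lra.
have [M HM] := Hbnd _ d0.
have M0 : 0 <= M := le_trans (normr_ge0 _) (HM 0%N _ (lexx _)).
have tay n y : x / 2 <= y -> `|F n y - F n x - (y - x) * G n x| <= M * (y - x) ^+ 2.
  move=> dy; apply: (taylor1_le _ _ _ _ _ _ _ (FG n) (GH n) (HM n) d0) => //; lra.
have /cvg_ex[l Gl] : cvg (G n x @[n --> \oo]).
  apply/cauchy_cvgP; apply: cauchy_exP => e e0.
  (* x / 2 keeps x + h in the range of the bound M; the second term makes the
     Taylor error M h less than e / 2, with M + 1 to avoid dividing by 0 *)
  pose h : R := Num.min (x / 2) (e / (2 * (M + 1))).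
  have h0 : 0 < h by rewrite lt_min d0 divr_gt0//; lra.
  have hM : M * h < e / 2.
    have : h <= e / (2 * (M + 1)) by rewrite ge_min lexx orbT.
    rewrite ler_pdivlMr; last lra.
    nra.
  exists ((f (x + h) - f x) / h).
  have xh0 : 0 < x + h by lra.
  have cq : (F n (x + h) - F n x) / h @[n --> \oo] --> (f (x + h) - f x) / h.
    by apply: cvgMl; apply: cvgB; apply: Ff.
  have e20 : 0 < e / 2 by lra.
  suff : \forall n \near \oo, ball ((f (x + h) - f x) / h) e (G n x) by [].
  have qnear : \forall n \near \oo, `|(f (x + h) - f x) / h - (F n (x + h) - F n x) / h| < e / 2.
    by move/cvgrPdist_lt : cq; apply.
  near=> n.
  have qn : `|(f (x + h) - f x) / h - (F n (x + h) - F n x) / h| < e / 2 by near: n.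
  rewrite /= /ball/=; have := tay n (x + h).
  have -> : x + h - x = h by ring.
  move=> /(_ _)/wrap[]; first by lra.
  move=> tn.
  have : `|(F n (x + h) - F n x) / h - G n x| <= M * h.
    rewrite -(ler_pM2r h0) -mulrA -expr2; apply: le_trans tn.
    rewrite -[X in _ * X](gtr0_norm h0) -normrM mulrBl divfK ?gt_eqF//.
    by rewrite (mulrC h).
  move=> h1; apply: (le_lt_trans (ler_distD ((F n (x + h) - F n x) / h) _ _)).
  lra.
have lim_tay y : x / 2 <= y -> `|f y - f x - (y - x) * l| <= M * (y - x) ^+ 2.
  move=> dy.
  have c : `|F n y - F n x - (y - x) * G n x| @[n --> \oo] --> `|f y - f x - (y - x) * l|.
    apply: cvg_norm; apply: cvgB; first by apply: cvgB; apply: Ff; lra.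
    exact: cvgMr.
  by apply: (cvgr_to_le c); apply: nearW => n; exact: tay.
pose q (h : R) : R := h^-1 *: ((f \o shift x) (h *: 1) - f x).
have ql : q h @[h --> (0 : R)^'] --> l.
  have -> : q = (fun h => (q h - l) + l) by apply/funext => h; rewrite subrK.
  rewrite -[X in _ --> X]add0r; apply: cvgD; last exact: cvg_cst.
  apply: (@cvg_to_0_linear _ _ M (x / 2)) => // r /andP[r0 rx].
  rewrite /q /= /GRing.scale/= mulr1.
  have := lim_tay (r + x); rewrite addrK => /(_ _)/wrap[].
    by have := ler_norm (- r); rewrite normrN; lra.
  rewrite -real_normK ?num_real// expr2 mulrA => h1.
  rewrite -(ler_pM2r r0) -normrM; apply: le_trans h1.
  rewrite mulrBl mulrC mulVKf; last by rewrite -normr_gt0.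
  by rewrite mulrC.
have dl : is_derive x 1 f l.
  apply: DeriveDef; first by apply/cvg_ex; exists l.
  exact: cvg_lim ql.
have <- : l = f^`()%classic x by rewrite derive1E; case: dl.
by [].
Unshelve. all: by end_near. Qed.

End positive_half_line.

(** * Gauss's limit formula *)

Section bohr_mollerup.
Context {R : realType}.
Implicit Types (x s t d : R) (n k : nat).

Lemma ln_addr_bound x s : 0 < x -> 0 <= s -> 0 <= ln (x + s) - ln x <= s / x.
Proof.
move=> x0 s0; have xs0 : 0 < x + s by lra.
rewrite subr_ge0 ler_ln ?posrE// lerDl s0/=.
rewrite -ln_div ?posrE//.
have -> : (x + s) / x = 1 + s / x by field; rewrite gt_eqF.
apply: le_ln1Dx; have := divr_ge0 s0 (ltW x0); lra.
Qed.

Lemma cvg_inv_nat s : s / n.+1%:R @[n --> \oo] --> (0 : R).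
Proof. by rewrite -[X in _ --> X](mulr0 s); apply: cvgMr; exact: cvg_harmonic. Qed.

(** The argument uses nothing about ln Gamma but these two properties. *)
Variable g : R -> R.
Hypothesis gS : forall x, 0 < x -> g (x + 1) = g x + ln x.
Hypothesis g_le : forall x s, 0 < x -> 0 <= s <= 1 -> g (x + s) <= g x + s * ln x.

(** The lower bound is the second hypothesis again, applied from x + s up to
    x + 1. *)
Lemma g_shift_bounds x s : 0 < x -> 0 <= s <= 1 ->
  - (s / x) <= g (x + s) - g x - s * ln x <= 0.
Proof.
move=> x0 s01; have /andP[s0 s1] := s01; have xs0 : 0 < x + s by lra.
have u := g_le x s x0 s01.
have s01' : 0 <= 1 - s <= 1 by apply/andP; split; lra.
have := g_le (x + s) (1 - s) xs0 s01'.
have -> : x + s + (1 - s) = x + 1 by ring.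
rewrite gS// => l.
have /andP[b0 b1] := ln_addr_bound x s x0 s0.
apply/andP; split; last by lra.
have : (1 - s) * (ln (x + s) - ln x) <= s / x.
  by apply: le_trans b1; rewrite ler_piMl//; lra.
move: l; set A := ln (_ + _); set B := ln _; lra.
Qed.

(** The case 0 <= x <= 1 is the squeeze above; adding 1 to x changes the
    sequence by ln (n + x) - ln n, which tends to 0. *)
Lemma g_shift_cvg x : 0 <= x ->
  g (n.+1%:R + x) - g n.+1%:R - x * ln n.+1%:R @[n --> \oo] --> (0 : R).
Proof.
pose D x n : R := g (n.+1%:R + x) - g n.+1%:R - x * ln n.+1%:R.
have small t : 0 <= t <= 1 -> D t n @[n --> \oo] --> (0 : R).
  move=> /andP[t0 t1].
  apply: (@squeeze_cvgr _ _ _ _ (fun n => - (t / n.+1%:R)) (fun=> 0)).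
  - by apply: nearW => n; apply: g_shift_bounds => //; rewrite t0.
  - by rewrite -[X in _ --> X]oppr0; apply: cvgN; exact: cvg_inv_nat.
  - exact: cvg_cst.
have step t : 0 <= t -> D t n @[n --> \oo] --> (0 : R) ->
    D (t + 1) n @[n --> \oo] --> (0 : R).
  move=> t0 Dt.
  have -> : D (t + 1) = (fun n => D t n + (ln (n.+1%:R + t) - ln n.+1%:R)).
    apply/funext => n; rewrite /D addrA gS; first by ring.
    by rewrite ltr_pwDl.
  rewrite -[X in _ --> X]addr0; apply: cvgD => //.
  apply: (@squeeze_cvgr _ _ _ _ (fun=> 0) (fun n => t / n.+1%:R)).
  - by apply: nearW => n; exact: ln_addr_bound.
  - exact: cvg_cst.
  - exact: cvg_inv_nat.
have all m t : 0 <= t -> t <= m%:R -> D t n @[n --> \oo] --> (0 : R).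
  elim: m t => [|m IH] t t0 tm; first by apply: small; rewrite t0/=; lra.
  have [t1|t1] := leP t 1; first by apply: small; rewrite t0.
  rewrite -(subrK 1 t); apply: step; first by lra.
  by apply: IH; [lra | rewrite -natr1 in tm; lra].
move=> x0; apply: (all (Num.truncn x).+1) => //.
exact/ltW/truncnS_gt.
Qed.

(** The index is shifted so that no logarithm is taken at 0. *)
Definition gauss_seq n x : R :=
  g n.+1%:R + x * ln n.+1%:R - \sum_(k < n.+1) ln (x + k%:R).

Lemma g_shift_sum x n : 0 < x ->
  g (x + n%:R) = g x + \sum_(k < n) ln (x + k%:R).
Proof.
move=> x0; elim: n => [|n IH]; first by rewrite big_ord0 !addr0.
by rewrite big_ord_recr/= addrA -IH -natr1 addrA gS// ltr_pwDl.
Qed.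

Lemma gauss_seq_cvg x : 0 < x -> gauss_seq n x @[n --> \oo] --> g x.
Proof.
move=> x0; rewrite -[X in _ --> X]subr0.
have -> : (fun n => gauss_seq n x) = (fun n => g x -
    (g (n.+1%:R + x) - g n.+1%:R - x * ln n.+1%:R)).
  apply/funext => n; rewrite /gauss_seq (addrC _ x) g_shift_sum//; ring.
by apply: cvgB; [exact: cvg_cst | apply: g_shift_cvg; exact: ltW].
Qed.

End bohr_mollerup.

(** * Derivatives of ln Gamma *)

Section log_gamma.
Context {R : realType}.
Implicit Types (x s t d : R) (n k : nat).

Definition lnGamma x : R := ln (Gamma x).

Lemma lnGammaS x : 0 < x -> lnGamma (x + 1) = lnGamma x + ln x.
Proof.
by move=> x0; rewrite /lnGamma GammaS// lnM ?posrE ?Gamma_gt0// addrC.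
Qed.

Lemma lnGamma_le x s : 0 < x -> 0 <= s <= 1 ->
  lnGamma (x + s) <= lnGamma x + s * ln x.
Proof.
move=> x0 s01; have /andP[s0 _] := s01; have xs0 : 0 < x + s by lra.
rewrite -ln_powR -lnM ?posrE ?powR_gt0 ?Gamma_gt0// mulrC.
by rewrite ler_ln ?posrE ?mulr_gt0 ?powR_gt0 ?Gamma_gt0//; exact: Gamma_le.
Qed.

Definition lnGamma_seq := gauss_seq lnGamma.

Lemma lnGamma_seq_cvg x : 0 < x -> lnGamma_seq n x @[n --> \oo] --> lnGamma x.
Proof. exact: (gauss_seq_cvg _ lnGammaS lnGamma_le). Qed.

Definition sum_inv_pow (p n : nat) x : R := \sum_(k < n.+1) ((x + k%:R)^-1) ^+ p.

Lemma is_derive_shift (c t : R) : is_derive t 1 (fun x => x + c) 1.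
Proof.
have -> : (fun x => x + c) = id + cst c by [].
by apply: is_derive_eq; rewrite addr0.
Qed.

Lemma is_derive_shift_inv p k t : 0 < t ->
  is_derive t 1 (fun x => ((x + k%:R)^-1) ^+ p) (- (p%:R * ((t + k%:R)^-1) ^+ p.+1)).
Proof.
move=> t0; have tk0 : t + k%:R != 0 by rewrite gt_eqF// ltr_wpDr.
have sh := is_derive_shift k%:R t.
have iv := @is_deriveV R (fun x => x + k%:R) t 1 1 tk0 sh.
have -> : (fun x => ((x + k%:R)^-1) ^+ p) = (fun x => (x + k%:R)^-1) ^+ p.
  by apply/funext => x; rewrite exprfctE.
apply: (is_derive_eq (is_deriveX p iv)).
case: p => [|p]; first by rewrite !mul0r oppr0 scale0r.
by rewrite /GRing.scale/= mulr1 mulrN -mulrA -exprVn -exprD addn2.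
Qed.

Lemma is_derive_sum_inv_pow p n t : 0 < t ->
  is_derive t 1 (sum_inv_pow p n) (- (p%:R * sum_inv_pow p.+1 n t)).
Proof.
move=> t0.
have -> : sum_inv_pow p n = \sum_(k < n.+1) (fun x => ((x + k%:R)^-1) ^+ p).
  by rewrite fct_sumE.
rewrite mulr_sumr -sumrN; apply: is_derive_sum => k; exact: is_derive_shift_inv.
Qed.

Lemma is_derive_lnGamma_seq n t : 0 < t ->
  is_derive t 1 (lnGamma_seq n) (ln n.+1%:R - sum_inv_pow 1 n t).
Proof.
move=> t0.
have -> : lnGamma_seq n = cst (lnGamma n.+1%:R) + (ln n.+1%:R \*: id)
    - \sum_(k < n.+1) (fun x => ln (x + k%:R)).
  by rewrite fct_sumE; apply/funext => x; rewrite /lnGamma_seq /gauss_seq (mulrC x).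
have dlin : is_derive t 1 (cst (lnGamma n.+1%:R) + (ln n.+1%:R \*: id)) (ln n.+1%:R).
  apply: (is_derive_eq (is_deriveD (is_derive_cst _ t 1)
    (is_deriveZ (ln n.+1%:R) (is_derive_id t 1)))).
  by rewrite add0r /GRing.scale/= mulr1.
apply: (is_deriveB dlin); apply: is_derive_sum => k; rewrite expr1.
have tk0 : 0 < t + k%:R by rewrite ltr_wpDr.
have sh := is_derive_shift k%:R t.
have := @is_derive1_comp R (@ln R) (fun x => x + k%:R) t _ _ (is_derive1_ln tk0) sh.
by rewrite mulr1.
Qed.

(** Telescoping: 1/(y+1)^2 <= 1/y - 1/(y+1). *)
Lemma sum_inv_sqr_le n d : 0 < d -> sum_inv_pow 2 n d <= d ^- 2 + d^-1.
Proof.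
move=> d0.
suff : sum_inv_pow 2 n d <= d ^- 2 + d^-1 - (d + n%:R)^-1.
  move=> /le_trans; apply; rewrite gerBl invr_ge0.
  by rewrite addr_ge0// ltW.
rewrite /sum_inv_pow; elim: n => [|n IH].
  by rewrite big_ord_recr big_ord0/= !add0r addr0 addrK exprVn.
rewrite big_ord_recr/=; apply: (le_trans (lerD IH (lexx _))).
rewrite -natr1 exprVn; set y := d + n%:R; rewrite addrA -/y.
have y0 : 0 < y by rewrite ltr_wpDr.
have y1 : 0 < y + 1 := addr_gt0 y0 ltr01.
suff : (y + 1) ^- 2 <= y^-1 - (y + 1)^-1 by lra.
have -> : y^-1 - (y + 1)^-1 = (y * (y + 1))^-1.
  by field; rewrite (gt_eqF y0) (gt_eqF y1).
rewrite lef_pV2 ?posrE ?(exprn_gt0 _ y1) ?(mulr_gt0 y0 y1)//.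
by rewrite expr2 ler_pM2r// lerDl.
Qed.

Lemma sum_inv_pow_ge0 p n x : 0 < x -> 0 <= sum_inv_pow p n x.
Proof.
by move=> x0; apply: sumr_ge0 => k _; rewrite exprn_ge0// invr_ge0 addr_ge0// ltW.
Qed.

Lemma sum_inv_pow_bound p d : 0 < d -> exists M, forall n t, d <= t ->
  sum_inv_pow p.+2 n t <= M.
Proof.
move=> d0; exists (d ^- p * (d ^- 2 + d^-1)) => n t dt.
have q0 : 0 <= d ^- p by rewrite invr_ge0 exprn_ge0// ltW.
apply: le_trans (ler_wpM2l q0 (@sum_inv_sqr_le n d d0)).
rewrite /sum_inv_pow mulr_sumr; apply: ler_sum => k _.
have k0 : 0 <= k%:R :> R by [].
rewrite -addn2 exprD -exprVn.
by apply: ler_pM; rewrite ?exprn_ge0 ?invr_ge0//; try lra;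
  rewrite lerXn2r ?nnegrE ?invr_ge0 ?lef_pV2 ?posrE; lra.
Qed.

Lemma lnGamma_deriv_cvg :
  (forall x, 0 < x -> is_derive x 1 lnGamma (lnGamma^`()%classic x)) /\
  (forall x, 0 < x -> (ln n.+1%:R - sum_inv_pow 1 n x) @[n --> \oo] --> lnGamma^`()%classic x).
Proof.
suff h x : 0 < x -> is_derive x 1 lnGamma (lnGamma^`()%classic x) /\
  (ln n.+1%:R - sum_inv_pow 1 n x) @[n --> \oo] --> lnGamma^`()%classic x.
  by split => x /h[].
move: x; apply: (cvg_deriv_of_bounded_deriv2 lnGamma_seq
  (fun n x => ln n.+1%:R - sum_inv_pow 1 n x) (fun n x => sum_inv_pow 2 n x)).
- by move=> n t; exact: is_derive_lnGamma_seq.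
- move=> n t t0.
  have h := is_deriveB (is_derive_cst (ln n.+1%:R) t 1) (is_derive_sum_inv_pow 1 n t t0).
  by apply: (is_derive_eq h); rewrite mul1r opprK add0r.
- move=> d d0; have [M HM] := sum_inv_pow_bound 0 d d0.
  exists M => n t dt; rewrite ger0_norm ?HM// sum_inv_pow_ge0//; lra.
- exact: lnGamma_seq_cvg.
Qed.

End log_gamma.

Section polygamma.
Context {R : realType}.
Implicit Types (x s t d : R) (n k : nat).

(** Differentiability of Gamma is read off from that of its logarithm, instead
    of differentiating under the integral sign. *)
Lemma Gamma_is_derive x : 0 < x ->
  is_derive x 1 (@Gamma R) (Gamma x * lnGamma^`()%classic x).
Proof.
move=> x0; have [dl _] := @lnGamma_deriv_cvg R.
apply: (@near_eq_is_derive _ _ _ (expR \o lnGamma)).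
  near=> t; rewrite /= /lnGamma lnK// posrE; apply: Gamma_gt0.
  by near: t; exact: lt_nbhsr.
have := @is_derive1_comp R expR lnGamma x _ _ (is_derive_expR _) (dl x x0).
by rewrite {1}/lnGamma lnK// posrE Gamma_gt0.
Unshelve. all: by end_near. Qed.

Lemma digammaE x : 0 < x -> digamma x = lnGamma^`()%classic x.
Proof.
move=> x0; rewrite /digamma derive1E.
have [_ ->] := Gamma_is_derive x x0.
by rewrite mulrAC divff ?mul1r// gt_eqF// Gamma_gt0.
Qed.

Lemma is_derive_lnGamma x : 0 < x -> is_derive x 1 lnGamma (digamma x).
Proof.
move=> x0; rewrite (digammaE x x0).
by have [dl _] := @lnGamma_deriv_cvg R; exact: (dl x x0).
Qed.

Definition trigamma : R -> R := (@digamma R)^`()%classic.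
Definition tetragamma : R -> R := trigamma^`()%classic.

Lemma digamma_deriv_cvg x : 0 < x -> is_derive x 1 (@digamma R) (trigamma x) /\
  (sum_inv_pow 2 n x @[n --> \oo] --> trigamma x).
Proof.
move: x; apply: (cvg_deriv_of_bounded_deriv2 (fun n x => ln n.+1%:R - sum_inv_pow 1 n x)
  (fun n x => sum_inv_pow 2 n x) (fun n x => - (2 * sum_inv_pow 3 n x))).
- move=> n t t0.
  have h := is_deriveB (is_derive_cst (ln n.+1%:R) t 1) (is_derive_sum_inv_pow 1 n t t0).
  by apply: (is_derive_eq h); rewrite mul1r opprK add0r.
- by move=> n t t0; exact: is_derive_sum_inv_pow.
- move=> d d0; have [M HM] := sum_inv_pow_bound 1 d d0.
  exists (2 * M) => n t dt; have t0 : 0 < t by lra.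
  rewrite normrN ger0_norm ?mulr_ge0 ?sum_inv_pow_ge0//.
  by rewrite ler_pM2l// HM.
- move=> t t0; rewrite (digammaE t t0).
  by have [_ cl] := @lnGamma_deriv_cvg R; exact: (cl t t0).
Qed.

Lemma trigamma_deriv_cvg x : 0 < x -> is_derive x 1 trigamma (tetragamma x) /\
  (- (2 * sum_inv_pow 3 n x) @[n --> \oo] --> tetragamma x).
Proof.
move: x; apply: (cvg_deriv_of_bounded_deriv2 (fun n x => sum_inv_pow 2 n x)
  (fun n x => - (2 * sum_inv_pow 3 n x)) (fun n x => 2 * (3 * sum_inv_pow 4 n x))).
- by move=> n t t0; exact: is_derive_sum_inv_pow.
- move=> n t t0.
  have h := is_deriveN (is_deriveZ 2 (is_derive_sum_inv_pow 3 n t t0)).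
  by apply: (is_derive_eq h); rewrite /GRing.scale/= mulrN opprK.
- move=> d d0; have [M HM] := sum_inv_pow_bound 2 d d0.
  exists (2 * (3 * M)) => n t dt; have t0 : 0 < t by lra.
  rewrite ger0_norm ?mulr_ge0 ?sum_inv_pow_ge0//.
  by rewrite !ler_pM2l// HM.
- by move=> t t0; have [] := digamma_deriv_cvg t t0.
Qed.

Lemma sum_inv_powS p n x :
  sum_inv_pow p n (x + 1) + x^-1 ^+ p = sum_inv_pow p n.+1 x.
Proof.
rewrite /sum_inv_pow [RHS]big_ord_recl addr0 addrC; congr (_ + _).
apply: eq_bigr => k _; rewrite /= /bump/= add1n -natr1; congr (_^-1 ^+ _); ring.
Qed.

Lemma sum_inv_cube_le n x : 0 < x -> sum_inv_pow 3 n x <= sum_inv_pow 2 n x / x.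
Proof.
move=> x0; rewrite /sum_inv_pow mulr_suml; apply: ler_sum => k _.
have k0 : 0 <= k%:R :> R by [].
have xk0 : 0 < x + k%:R by lra.
rewrite exprSr ler_wpM2l ?exprn_ge0 ?invr_ge0 ?(ltW xk0)//.
by rewrite lef_pV2 ?posrE// lerDl.
Qed.

(* from here on only the recurrence and the bounds of the sums matter; unfolding
   them makes convertibility tests expensive *)
Local Opaque sum_inv_pow.

Lemma cvg_tail (u : nat -> R) (l : R) :
  u n @[n --> \oo] --> l -> u n.+1 @[n --> \oo] --> l.
Proof. by rewrite cvg_shiftS. Qed.

Lemma eq_cvg_seq (u v : nat -> R) (l : R) :
  u =1 v -> u n @[n --> \oo] --> l -> v n @[n --> \oo] --> l.
Proof. by move=> /funext ->. Qed.

Lemma trigammaS x : 0 < x -> trigamma (x + 1) = trigamma x - x ^- 2.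
Proof.
move=> x0; have [_ c] := digamma_deriv_cvg x x0.
have x10 : 0 < x + 1 by lra.
have [_ c1] := digamma_deriv_cvg _ x10.
apply/eqP; rewrite eq_sym subr_eq; apply/eqP.
have {}c : sum_inv_pow 2 n.+1 x @[n --> \oo] --> trigamma x.
  exact: (cvg_tail _ _ c).
apply: (cvg_unique _ c) => //.
have c2 : sum_inv_pow 2 n (x + 1) + x ^- 2 @[n --> \oo] --> trigamma (x + 1) + x ^- 2.
  exact: (cvgD c1 (cvg_cst _)).
apply: eq_cvg_seq c2 => n.
by rewrite -sum_inv_powS -exprVn.
Qed.

Lemma tetragammaS x : 0 < x -> tetragamma (x + 1) = tetragamma x + 2 * x ^- 3.
Proof.
move=> x0; have [_ c] := trigamma_deriv_cvg x x0.
have x10 : 0 < x + 1 by lra.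
have [_ c1] := trigamma_deriv_cvg _ x10.
have {}c : - (2 * sum_inv_pow 3 n.+1 x) @[n --> \oo] --> tetragamma x.
  exact: (cvg_tail _ _ c).
have c2 : - (2 * sum_inv_pow 3 n.+1 x) + 2 * x ^- 3 @[n --> \oo] --> tetragamma x + 2 * x ^- 3.
  exact: (cvgD c (cvg_cst _)).
apply: (cvg_unique _ c1) => //; apply: eq_cvg_seq c2 => n.
by rewrite -sum_inv_powS -exprVn; ring.
Qed.

(** Strict positivity comes from isolating the first term of the series, the
    limit of the partial sums giving only a weak inequality. *)
Lemma trigamma_bounds x : 0 < x -> 0 < trigamma x <= x ^- 2 + x^-1.
Proof.
move=> x0; have [_ c] := digamma_deriv_cvg x x0; apply/andP; split.
  have x10 : 0 < x + 1 by lra.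
  have [_ c1] := digamma_deriv_cvg _ x10.
  have : 0 <= trigamma (x + 1).
    by apply: (cvgr_to_ge c1); apply: nearW => n; exact: sum_inv_pow_ge0.
  rewrite trigammaS// subr_ge0; apply: lt_le_trans.
  by rewrite invr_gt0 exprn_gt0.
by apply: (cvgr_to_le c); apply: nearW => n; exact: sum_inv_sqr_le.
Qed.

Lemma tetragamma_bounds x : 0 < x -> - (2 * (x ^- 2 + x^-1)) / x <= tetragamma x < 0.
Proof.
move=> x0; have [_ c] := trigamma_deriv_cvg x x0; apply/andP; split.
  apply: (cvgr_to_ge c); apply: nearW => n.
  rewrite mulNr lerN2 -mulrA ler_pM2l//.
  apply: (@le_trans _ _ (sum_inv_pow 2 n x / x)); last first.
    by rewrite ler_pM2r ?invr_gt0//; exact: sum_inv_sqr_le.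
  exact: sum_inv_cube_le.
have x10 : 0 < x + 1 by lra.
have [_ c1] := trigamma_deriv_cvg _ x10.
have : tetragamma (x + 1) <= 0.
  apply: (cvgr_to_le c1); apply: nearW => n.
  by rewrite oppr_le0 mulr_ge0// sum_inv_pow_ge0.
rewrite tetragammaS// => h; have : 0 < x ^- 3 by rewrite invr_gt0 exprn_gt0.
lra.
Qed.

(** A sequence that decreases strictly to 0 is positive.  Working with unit
    shifts of D turns inequalities between series into inequalities between
    their general terms. *)
Lemma gt0_of_shift_decr (D : R -> R) z : (forall t, z <= t -> D (t + 1) < D t) ->
  D (z + n%:R) @[n --> \oo] --> (0 : R) -> 0 < D z.
Proof.
move=> decr c.
have step n : D (z + n.+1%:R) <= D (z + 1).
  elim: n => [|n IH]; first by [].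
  by apply: le_trans IH; rewrite -(natr1 n.+1) addrA ltW// decr// lerDl.
apply: le_lt_trans (decr z (lexx z)).
have {}c : D (z + n.+1%:R) @[n --> \oo] --> (0 : R).
  exact: (cvg_tail _ _ c).
by apply: (cvgr_to_le c); apply: nearW => n; exact: step.
Qed.

End polygamma.

(** * Inequalities between trigamma and tetragamma *)

Section trigamma_inequalities.
Context {R : realType}.
Implicit Types (x y z t a : R) (n : nat).

(** The comparison z + n >= z (n + 1) / (1 + z) avoids a case distinction on
    the size of z. *)
Lemma cvg_inv_shift z : 0 < z -> (z + n%:R)^-1 @[n --> \oo] --> (0 : R).
Proof.
move=> z0.
apply: (@squeeze_cvgr _ _ _ _ (fun=> 0) (fun n => ((1 + z) / z) / n.+1%:R)).
- apply: nearW => n; have n0 : 0 <= n%:R :> R by [].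
  have zn0 : 0 < z + n%:R by lra.
  rewrite invr_ge0 (ltW zn0)/= -[leLHS]mul1r ler_pdivrMr// mulrAC ler_pdivlMr//.
  by rewrite mul1r mulrAC ler_pdivlMr// -natr1; nra.
- exact: cvg_cst.
- exact: cvg_inv_nat.
Qed.

(** Common upper bound of trigamma (z + n) and of
    - (z + n) tetragamma (z + n) / 2. *)
Let pole_bound z n : R := (z + n%:R) ^- 2 + (z + n%:R)^-1.

Lemma cvg_pole_bound z : 0 < z -> pole_bound z n @[n --> \oo] --> (0 : R).
Proof.
move=> z0; have c := cvg_inv_shift z z0.
have cc : (z + n%:R)^-1 * (z + n%:R)^-1 + (z + n%:R)^-1 @[n --> \oo] --> (0 * 0 + 0 : R).
  exact: (cvgD (cvgM c c) c).
rewrite mulr0 addr0 in cc.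
apply: (eq_cvg_seq _ _ _ _ cc) => n.
by rewrite /pole_bound -exprVn expr2.
Qed.

Lemma cvg_trigamma z : 0 < z -> trigamma (z + n%:R) @[n --> \oo] --> (0 : R).
Proof.
move=> z0; apply: (@squeeze_cvgr _ _ _ _ (fun=> 0) (pole_bound z)); last exact: cvg_pole_bound.
- apply: nearW => n; have zn0 : 0 < z + n%:R by rewrite ltr_wpDr.
  by have /andP[/ltW -> ->] := trigamma_bounds _ zn0.
- exact: cvg_cst.
Qed.

Lemma cvg_mul_tetragamma z c : 0 < z -> 0 <= c <= z ->
  (z + n%:R - c) * tetragamma (z + n%:R) @[n --> \oo] --> (0 : R).
Proof.
move=> z0 /andP[c0 cz].
apply: (@squeeze_cvgr _ _ _ _ (fun n => - (2 * pole_bound z n)) (fun=> 0)).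
- apply: nearW => n; have zn0 : 0 < z + n%:R by rewrite ltr_wpDr.
  have /andP[l u] := tetragamma_bounds _ zn0.
  have n0 : 0 <= n%:R :> R by [].
  rewrite ler_pdivrMr// in l; rewrite /pole_bound; apply/andP; split; nra.
- rewrite -[X in _ --> X]oppr0 -[X in - X](mulr0 (2 : R)).
  by apply: cvgN; apply: cvgMr; exact: cvg_pole_bound.
- exact: cvg_cst.
Qed.

Lemma cvg_tetragamma z : 0 < z -> tetragamma (z + n%:R) @[n --> \oo] --> (0 : R).
Proof.
move=> z0; have z00 : 0 <= (0 : R) <= z by rewrite lexx ltW.
have c : (z + n%:R)^-1 * ((z + n%:R - 0) * tetragamma (z + n%:R)) @[n --> \oo]
    --> (0 * 0 : R).
  exact: (cvgM (cvg_inv_shift _ z0) (cvg_mul_tetragamma _ _ z0 z00)).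
rewrite mul0r in c; apply: (eq_cvg_seq _ _ _ _ c) => n.
have zn0 : 0 < z + n%:R by rewrite ltr_wpDr.
by rewrite /= subr0 mulrA mulVf ?mul1r// gt_eqF.
Qed.

(** 1/(t - 1/2) - 1/(t + 1/2) = 1/(t^2 - 1/4) exceeds 1/t^2. *)
Lemma trigamma_lt z : 2^-1 < z -> trigamma z < (z - 2^-1)^-1.
Proof.
move=> z2; have z0 : 0 < z by lra.
rewrite -subr_gt0; apply: (gt0_of_shift_decr (fun t => (t - 2^-1)^-1 - trigamma t)).
  move=> t zt; rewrite trigammaS; last lra.
  rewrite -subr_gt0.
  have -> : (t - 2^-1)^-1 - trigamma t - ((t + 1 - 2^-1)^-1 - (trigamma t - t ^- 2))
     = 4^-1 * ((t - 2^-1) * (t + 2^-1) * t ^+ 2)^-1.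
    by field; apply/and3P; split; apply: lt0r_neq0; lra.
  by rewrite mulr_gt0// invr_gt0 !mulr_gt0 ?exprn_gt0//; lra.
rewrite -[X in _ --> X](subr0 (0 : R)); apply: cvgB; last exact: cvg_trigamma.
have z20 : 0 < z - 2^-1 by lra.
apply: (eq_cvg_seq _ _ _ _ (cvg_inv_shift _ z20)) => n.
by rewrite addrAC.
Qed.

(** 1/(t - 1/2)^2 - 1/(t + 1/2)^2 = 2 t / (t^2 - 1/4)^2 exceeds 2/t^3. *)
Lemma tetragamma_gt z : 2^-1 < z -> - (z - 2^-1) ^- 2 < tetragamma z.
Proof.
move=> z2; have z0 : 0 < z by lra.
rewrite -subr_gt0 opprK; apply: (gt0_of_shift_decr (fun t => tetragamma t + (t - 2^-1) ^- 2)).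
  move=> t zt; rewrite tetragammaS; last lra.
  rewrite -subr_gt0.
  have -> : tetragamma t + (t - 2^-1) ^- 2 - (tetragamma t + 2 * t ^- 3 + (t + 1 - 2^-1) ^- 2)
     = (t ^+ 2 - 8^-1) * ((t - 2^-1) ^+ 2 * (t + 2^-1) ^+ 2 * t ^+ 3)^-1.
    by field; apply/and3P; split; apply: lt0r_neq0; lra.
  rewrite mulr_gt0// ?invr_gt0 ?mulr_gt0 ?exprn_gt0//; try lra; nra.
rewrite -[X in _ --> X](addr0 (0 : R)); apply: cvgD; first exact: cvg_tetragamma.
have z20 : 0 < z - 2^-1 by lra.
have c := cvg_inv_shift _ z20.
have cc : (z - 2^-1 + n%:R)^-1 * (z - 2^-1 + n%:R)^-1 @[n --> \oo] --> (0 * 0 : R).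
  exact: (cvgM c c).
rewrite mulr0 in cc; apply: eq_cvg_seq cc => n.
by rewrite -exprVn expr2 addrAC.
Qed.

(** The trapezoidal counterpart of the previous midpoint bound. *)
Lemma tetragamma_lt z : 0 < z -> tetragamma z < - (z ^- 2 + z ^- 3).
Proof.
move=> z0; rewrite -subr_gt0.
apply: (gt0_of_shift_decr (fun t => - (t ^- 2 + t ^- 3) - tetragamma t)).
  move=> t zt; rewrite tetragammaS; last lra.
  rewrite -subr_gt0.
  have -> : - (t ^- 2 + t ^- 3) - tetragamma t -
     (- ((t + 1) ^- 2 + (t + 1) ^- 3) - (tetragamma t + 2 * t ^- 3))
     = (2 * t + 1) * (t ^+ 3 * (t + 1) ^+ 3)^-1.
    by field; apply/andP; split; apply: lt0r_neq0; lra.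
  by rewrite mulr_gt0 ?invr_gt0 ?mulr_gt0 ?exprn_gt0//; lra.
have c := cvg_inv_shift _ z0.
have cc : - ((z + n%:R)^-1 * (z + n%:R)^-1 + (z + n%:R)^-1 * ((z + n%:R)^-1 * (z + n%:R)^-1))
    - tetragamma (z + n%:R) @[n --> \oo] --> (- (0 * 0 + 0 * (0 * 0)) - 0 : R).
  exact: (cvgB (cvgN (cvgD (cvgM c c) (cvgM c (cvgM c c)))) (cvg_tetragamma _ z0)).
rewrite !mulr0 addr0 subr0 oppr0 in cc; apply: (eq_cvg_seq _ _ _ _ cc) => n.
by rewrite -!exprVn !exprS expr0 !mulr1.
Qed.

(** The sign of the derivative of x trigamma (x + 1/2), with z = x + 1/2.
    Shifting z by 1 lowers the left-hand side by
    - tetragamma z - 1/z^2 - 1/z^3, positive by the trapezoidal bound. *)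
Lemma mul_trigamma_deriv_gt0 z : 2^-1 < z -> 0 < trigamma z + (z - 2^-1) * tetragamma z.
Proof.
move=> z2; have z0 : 0 < z by lra.
apply: (gt0_of_shift_decr (fun t => trigamma t + (t - 2^-1) * tetragamma t)).
  move=> t zt; have t0 : 0 < t by lra.
  rewrite tetragammaS// trigammaS//.
  have := tetragamma_lt t t0.
  have -> : (t + 1 - 2^-1) * (tetragamma t + 2 * t ^- 3) =
     (t - 2^-1) * tetragamma t + tetragamma t + 2 * t ^- 2 + t ^- 3.
    field; exact: lt0r_neq0.
  lra.
rewrite -[X in _ --> X](addr0 (0 : R)); apply: cvgD; first exact: cvg_trigamma.
by apply: cvg_mul_tetragamma => //; lra.
Qed.

End trigamma_inequalities.

(** * Monotonicity and convexity from derivatives *)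

Section monotonicity.
Context {R : realType}.
Implicit Types (f df : R -> R) (x y t : R).

Lemma gt0_derive_incr f df x y :
  (forall t, 0 < t -> is_derive t 1 f (df t)) -> (forall t, 0 < t -> 0 < df t) ->
  0 < x -> x < y -> f x < f y.
Proof.
move=> fdf df0 x0 xy; have [c /andP[xc cy] e] := @MVT_pos R f df x y fdf x0 xy.
by rewrite -subr_gt0 e mulr_gt0 ?subr_gt0// df0// (lt_trans x0).
Qed.

Lemma gt0_of_derive f df x :
  (forall t, 0 <= t -> is_derive t 1 f (df t)) -> (forall t, 0 < t -> 0 < df t) ->
  0 <= f 0 -> 0 < x -> 0 < f x.
Proof.
move=> fdf df0 f00 x0.
have [t||c] := @MVT R f df 0 x x0.
- by rewrite in_itv/= => /andP[t0 _]; exact/fdf/ltW.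
- apply: derivable_within_continuous => t; rewrite in_itv/= => /andP[t0 _].
  by have [] := fdf t t0.
rewrite in_itv/= subr0 => /andP[c0 _] e.
have := mulr_gt0 (df0 c c0) x0; lra.
Qed.

Lemma midpoint_lt f df x y :
  (forall t, 0 < t -> is_derive t 1 f (df t)) ->
  (forall s t, 0 < s -> s < t -> df s < df t) ->
  0 < x -> 0 < y -> x != y -> f ((x + y) / 2) < (f x + f y) / 2.
Proof.
move=> fdf dfi.
wlog xy : x y / x < y => [W x0 y0 xNy|x0 y0 _].
  have [xy|yx] := ltP x y; first exact: W.
  rewrite addrC (addrC (f x)); apply: W => //; last by rewrite eq_sym.
  by rewrite lt_neqAle eq_sym xNy.
have m0 : 0 < (x + y) / 2 by lra.
have xm : x < (x + y) / 2 by lra.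
have my : (x + y) / 2 < y by lra.
have [c /andP[xc cm] e1] := @MVT_pos R f df _ _ fdf x0 xm.
have [d /andP[md dy] e2] := @MVT_pos R f df _ _ fdf m0 my.
have c0 : 0 < c by lra.
have cd : df c < df d by apply: dfi; lra.
have l : (x + y) / 2 - x = (y - x) / 2 by field.
have r : y - (x + y) / 2 = (y - x) / 2 by field.
rewrite l in e1; rewrite r in e2.
have : df c * ((y - x) / 2) < df d * ((y - x) / 2) by rewrite ltr_pM2r//; lra.
lra.
Qed.

(** The derivative vanishes between the two zeros, hence is negative on the
    left of 1 and positive on the right of 2. *)
Lemma convex_ge0_outside_zeros f df x :
  (forall t, 0 < t -> is_derive t 1 f (df t)) ->
  (forall s t, 0 < s -> s < t -> df s < df t) ->
  f 1 = 0 -> f 2 = 0 -> 0 < x -> x <= 1 \/ 2 <= x -> 0 <= f x.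
Proof.
move=> fdf dfi f1 f2 x0.
have [c /andP[c1 c2] e] := @MVT_pos R f df 1 2 fdf ltr01 (ltr1n R 2).
have dc : df c = 0 by move: e; rewrite f1 f2; lra.
case; rewrite le_eqVlt => /predU1P[].
- by move=> ->; rewrite f1.
- move=> x1; have [d /andP[xd d1]] := @MVT_pos R f df x 1 fdf x0 x1.
  by rewrite f1 => {}e; have : df d < df c; [apply: dfi; lra | rewrite dc; nra].
- by move=> <-; rewrite f2.
- move=> x2; have [d /andP[d2 dx]] := @MVT_pos R f df 2 x fdf (ltr0n R 2) x2.
  by rewrite f2 => {}e; have : df c < df d; [apply: dfi; lra | rewrite dc; nra].
Qed.

End monotonicity.

(** * The function ln Gamma (x + a) / x *)

Section normalized_lnGamma.
Context {R : realType}.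
Implicit Types (a x y t : R).

Lemma digamma_incr x y : 0 < x -> x < y -> @digamma R x < digamma y.
Proof.
apply: (gt0_derive_incr (@digamma R) trigamma).
  by move=> t t0; have [] := digamma_deriv_cvg t t0.
by move=> t t0; have /andP[] := trigamma_bounds t t0.
Qed.

Lemma lnGamma1 : lnGamma (1 : R) = 0.
Proof. by rewrite /lnGamma Gamma1 ln1. Qed.

Lemma lnGamma2 : lnGamma (2 : R) = 0.
Proof. by rewrite -[2]/(1 + 1) lnGammaS// lnGamma1 ln1 addr0. Qed.

Lemma lnGamma_ge0 a : 0 < a -> a <= 1 \/ 2 <= a -> 0 <= lnGamma a.
Proof.
exact: (convex_ge0_outside_zeros _ _ _ is_derive_lnGamma digamma_incr lnGamma1 lnGamma2).
Qed.

Variable a : R.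
Hypothesis a0 : 0 < a.

Definition ln_root x := lnGamma (x + a) / x.
(** Numerator of the derivative of [ln_root]: ln_root' x = ln_root_num x / x^2.
    The quotient ln_root_num x / x, the derivative of [ln_root] with respect to
    ln x, is called its elasticity below. *)
Definition ln_root_num x := x * digamma (x + a) - lnGamma (x + a).

Let shifted (f df : R -> R) : (forall t, 0 < t -> is_derive t 1 f (df t)) ->
  forall t, 0 <= t -> is_derive t 1 (fun x => f (x + a)) (df (t + a)).
Proof.
move=> fdf t t0; have ta0 : 0 < t + a by rewrite ltr_wpDl.
have := @is_derive1_comp R f (fun x => x + a) t _ _ (fdf _ ta0) (is_derive_shift a t).
by rewrite mulr1.
Qed.

Let dL t : 0 <= t -> is_derive t 1 (fun x => lnGamma (x + a)) (digamma (t + a)).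
Proof. exact: (shifted _ _ is_derive_lnGamma). Qed.

Let dP t : 0 <= t -> is_derive t 1 (fun x => @digamma R (x + a)) (trigamma (t + a)).
Proof. by apply: shifted => s s0; have [] := digamma_deriv_cvg s s0. Qed.

Let dQ t : 0 <= t -> is_derive t 1 (fun x => @trigamma R (x + a)) (tetragamma (t + a)).
Proof. by apply: shifted => s s0; have [] := trigamma_deriv_cvg s s0. Qed.

Let dxmul (f : R -> R) t df : is_derive t 1 f df ->
  is_derive t 1 (fun x => x * f x) (f t + t * df).
Proof.
move=> fdf; apply: (is_derive_eq (is_deriveM (is_derive_id t 1) fdf)).
by rewrite /GRing.scale/= mulr1 addrC.
Qed.

Lemma is_derive_ln_root_num t : 0 <= t -> is_derive t 1 ln_root_num (t * trigamma (t + a)).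
Proof.
move=> t0; apply: (is_derive_eq (is_deriveB (dxmul _ _ _ (dP t t0)) (dL t t0))).
by ring.
Qed.

Lemma ln_root_num0 : ln_root_num 0 = - lnGamma a.
Proof. by rewrite /ln_root_num mul0r !add0r. Qed.

Let dxxQ t : 0 <= t -> is_derive t 1 (fun x => x * (x * trigamma (x + a)))
  (2 * t * trigamma (t + a) + t ^+ 2 * tetragamma (t + a)).
Proof.
by move=> t0; apply: (is_derive_eq (dxmul _ _ _ (dxmul _ _ _ (dQ t t0)))); ring.
Qed.

Let half t : 2^-1 <= a -> 0 < t -> 2^-1 < t + a.
Proof. by move=> a2 t0; rewrite ltr_pwDl. Qed.

Lemma ln_root_num_lt x : 2^-1 <= a -> 0 <= lnGamma a -> 0 < x -> ln_root_num x < x.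
Proof.
move=> a2 ga x0; rewrite -subr_gt0.
apply: (gt0_of_derive (fun x => x - ln_root_num x) (fun x => 1 - x * trigamma (x + a)) x _ _ _ x0).
- by move=> t t0; apply: (is_deriveB (is_derive_id t 1) (is_derive_ln_root_num t t0)).
- move=> t t0; rewrite subr_gt0.
  have := trigamma_lt _ (half t a2 t0).
  have -> : t + a - 2^-1 = t + (a - 2^-1) by ring.
  move=> h; have l : trigamma (t + a) < t^-1.
    by apply: lt_le_trans h _; rewrite lef_pV2 ?posrE; lra.
  by rewrite -(ltr_pM2l t0) divff ?gt_eqF// in l.
- by rewrite ln_root_num0; lra.
Qed.

(** x^3 times the second derivative of ln_root - ln. *)
Lemma ln_root_sub_ln_deriv2_gt0 x : 2^-1 <= a -> 0 <= lnGamma a ->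
  0 < x -> 0 < x * (x * trigamma (x + a)) - 2 * ln_root_num x + x.
Proof.
move=> a2 ga x0.
apply: (gt0_of_derive (fun x => x * (x * trigamma (x + a)) - 2 * ln_root_num x + x)
  (fun x => 1 + x ^+ 2 * tetragamma (x + a)) x _ _ _ x0).
- move=> t t0; apply: (is_derive_eq (is_deriveD (is_deriveB (dxxQ t t0)
    (is_deriveZ 2 (is_derive_ln_root_num t t0))) (is_derive_id t 1))).
  by rewrite /GRing.scale/=; ring.
- move=> t t0; have := tetragamma_gt _ (half t a2 t0).
  have -> : t + a - 2^-1 = t + (a - 2^-1) by ring.
  move=> h; have l : - t ^- 2 < tetragamma (t + a).
    apply: le_lt_trans h; rewrite lerN2 lef_pV2 ?posrE ?exprn_gt0//; try lra.
    by rewrite lerXn2r ?nnegrE; lra.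
  have t20 : 0 < t ^+ 2 by rewrite exprn_gt0.
  by rewrite -(ltr_pM2l t20) mulrN divff ?gt_eqF// in l; lra.
- by rewrite ln_root_num0; lra.
Qed.

(** x^2 times the derivative of the elasticity.  The derivative of this
    quantity is x (Q + x Q') with Q = trigamma (x + a); as Q' < 0 and
    x <= x + a - 1/2, it is at least x (Q + (x + a - 1/2) Q'). *)
Lemma elasticity_deriv_gt0 x : 2^-1 <= a -> 0 <= lnGamma a ->
  0 < x -> 0 < x * (x * trigamma (x + a)) - ln_root_num x.
Proof.
move=> a2 ga x0.
apply: (gt0_of_derive (fun x => x * (x * trigamma (x + a)) - ln_root_num x)
  (fun x => x * (trigamma (x + a) + x * tetragamma (x + a))) x _ _ _ x0).
- move=> t t0; apply: (is_derive_eq (is_deriveB (dxxQ t t0) (is_derive_ln_root_num t t0))).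
  by ring.
- move=> t t0; rewrite mulr_gt0//; apply: lt_le_trans (mul_trigamma_deriv_gt0 _ (half t a2 t0)) _.
  have ta0 : 0 < t + a := addr_gt0 t0 a0.
  have /andP[_ neg] := tetragamma_bounds _ ta0.
  by rewrite lerD2l ler_wnM2r ?(ltW neg)//; lra.
- by rewrite ln_root_num0; lra.
Qed.

Lemma ln_root_num_gt0 x : lnGamma a = 0 -> 0 < x -> 0 < ln_root_num x.
Proof.
move=> ga x0; apply: (gt0_of_derive ln_root_num (fun x => x * trigamma (x + a)) x _ _ _ x0).
- exact: is_derive_ln_root_num.
- move=> t t0; rewrite mulr_gt0//; have ta0 : 0 < t + a := addr_gt0 t0 a0.
  by have /andP[] := trigamma_bounds _ ta0.
- by rewrite ln_root_num0 ga oppr0.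
Qed.

(** Minus x^3 times the second derivative of ln_root. *)
Lemma ln_root_deriv2_lt0 x : lnGamma a = 0 ->
  0 < x -> 0 < 2 * ln_root_num x - x * (x * trigamma (x + a)).
Proof.
move=> ga x0.
apply: (gt0_of_derive (fun x => 2 * ln_root_num x - x * (x * trigamma (x + a)))
  (fun x => - (x ^+ 2 * tetragamma (x + a))) x _ _ _ x0).
- move=> t t0; apply: (is_derive_eq (is_deriveB
    (is_deriveZ 2 (is_derive_ln_root_num t t0)) (dxxQ t t0))).
  by rewrite /GRing.scale/=; ring.
- move=> t t0; have ta0 : 0 < t + a := addr_gt0 t0 a0.
  have /andP[_ neg] := tetragamma_bounds _ ta0.
  by rewrite oppr_gt0 pmulr_rlt0// exprn_gt0.
- by rewrite ln_root_num0 ga; lra.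
Qed.

Let dV t : 0 < t -> is_derive t 1 (fun x : R => x^-1) (- t ^- 2).
Proof.
move=> t0; have tn0 : id t != 0 :> R by rewrite gt_eqF.
by apply: (is_derive_eq (is_deriveV tn0 (is_derive_id t 1))); rewrite /GRing.scale/= mulr1.
Qed.

Let dV2 t : 0 < t -> is_derive t 1 (fun x : R => x^-1 * x^-1) (- 2 * t ^- 3).
Proof.
move=> t0; apply: (is_derive_eq (is_deriveM (dV t t0) (dV t t0))).
by rewrite /GRing.scale/=; field; rewrite gt_eqF.
Qed.

Lemma is_derive_ln_root t : 0 < t -> is_derive t 1 ln_root (ln_root_num t / t ^+ 2).
Proof.
move=> t0; apply: (is_derive_eq (is_deriveM (dL t (ltW t0)) (dV t t0))).
by rewrite /ln_root_num /GRing.scale/=; field; rewrite gt_eqF.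
Qed.

Let is_derive_ln_root_deriv t : 0 < t ->
  is_derive t 1 (fun x => ln_root_num x / x ^+ 2)
    ((t * (t * trigamma (t + a)) - 2 * ln_root_num t) / t ^+ 3).
Proof.
move=> t0; have e : (fun x => ln_root_num x / x ^+ 2) = (fun x => ln_root_num x * (x^-1 * x^-1)).
  by apply/funext => x; rewrite expr2 invfM.
rewrite e; apply: (is_derive_eq (is_deriveM (is_derive_ln_root_num t (ltW t0)) (dV2 t t0))).
by rewrite /GRing.scale/=; field; rewrite gt_eqF.
Qed.

Lemma ln_root_sub_ln_decr x y : 2^-1 <= a -> 0 <= lnGamma a -> 0 < x -> x < y ->
  ln_root y - ln y < ln_root x - ln x.
Proof.
move=> a2 ga x0 xy; rewrite -ltrN2 !opprB.
apply: (gt0_derive_incr (fun x => ln x - ln_root x)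
  (fun x => (x - ln_root_num x) / x ^+ 2) x y) => //.
- move=> t t0; apply: (is_derive_eq (is_deriveB (is_derive1_ln t0) (is_derive_ln_root t t0))).
  by field; rewrite gt_eqF.
- by move=> t t0; rewrite divr_gt0 ?exprn_gt0// subr_gt0 ln_root_num_lt.
Qed.

Lemma ln_root_incr x y : lnGamma a = 0 -> 0 < x -> x < y -> ln_root x < ln_root y.
Proof.
move=> ga; apply: (gt0_derive_incr _ (fun x => ln_root_num x / x ^+ 2)).
- exact: is_derive_ln_root.
- by move=> t t0; rewrite divr_gt0 ?exprn_gt0// ln_root_num_gt0.
Qed.

Lemma ln_root_sub_ln_midpoint x y : 2^-1 <= a -> 0 <= lnGamma a ->
  0 < x -> 0 < y -> x != y ->
  ln_root ((x + y) / 2) - ln ((x + y) / 2) < ((ln_root x - ln x) + (ln_root y - ln y)) / 2.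
Proof.
move=> a2 ga; apply: (midpoint_lt (fun x => ln_root x - ln x)
  (fun x => ln_root_num x / x ^+ 2 - x^-1)).
- by move=> t t0; apply: (is_deriveB (is_derive_ln_root t t0) (is_derive1_ln t0)).
- move=> s t; apply: (gt0_derive_incr (fun x => ln_root_num x / x ^+ 2 - x^-1)
    (fun x => (x * (x * trigamma (x + a)) - 2 * ln_root_num x + x) / x ^+ 3)).
  + move=> {}t t0; apply: (is_derive_eq (is_deriveB (is_derive_ln_root_deriv t t0) (dV t t0))).
    by field; rewrite gt_eqF.
  + by move=> {}t t0; rewrite divr_gt0 ?exprn_gt0// ln_root_sub_ln_deriv2_gt0.
Qed.

Lemma ln_root_midpoint x y : lnGamma a = 0 -> 0 < x -> 0 < y -> x != y ->
  (ln_root x + ln_root y) / 2 < ln_root ((x + y) / 2).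
Proof.
move=> ga x0 y0 xy.
suff : - ln_root ((x + y) / 2) < (- ln_root x + - ln_root y) / 2 by lra.
apply: (midpoint_lt (fun x => - ln_root x) (fun x => - (ln_root_num x / x ^+ 2))) => //.
- by move=> t t0; apply: (is_deriveN (is_derive_ln_root t t0)).
- move=> s t; apply: (gt0_derive_incr (fun x => - (ln_root_num x / x ^+ 2))
    (fun x => (2 * ln_root_num x - x * (x * trigamma (x + a))) / x ^+ 3)).
  + move=> {}t t0; apply: (is_derive_eq (is_deriveN (is_derive_ln_root_deriv t t0))).
    by rewrite -mulNr opprB.
  + by move=> {}t t0; rewrite divr_gt0 ?exprn_gt0// ln_root_deriv2_lt0.
Qed.

Lemma elasticity_incr x y : 2^-1 <= a -> 0 <= lnGamma a -> 0 < x -> x < y ->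
  ln_root_num x / x < ln_root_num y / y.
Proof.
move=> a2 ga; apply: (gt0_derive_incr (fun x => ln_root_num x / x)
  (fun x => (x * (x * trigamma (x + a)) - ln_root_num x) / x ^+ 2)).
- move=> t t0; apply: (is_derive_eq (is_deriveM (is_derive_ln_root_num t (ltW t0)) (dV t t0))).
  by rewrite /GRing.scale/=; field; rewrite gt_eqF.
- by move=> t t0; rewrite divr_gt0 ?exprn_gt0// elasticity_deriv_gt0.
Qed.

(** The chord of ln_root, as a function of ln x, lies above its tangent at y:
    the difference of the two has a derivative with the sign of the difference
    of the elasticities at x and y, so it is minimal at y only. *)
Lemma ln_root_tangent x y : 2^-1 <= a -> 0 <= lnGamma a -> 0 < x -> 0 < y -> x != y ->
  ln_root_num y / y * (ln x - ln y) < ln_root x - ln_root y.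
Proof.
move=> a2 ga x0 y0 xy.
pose k t := ln_root t - ln_root_num y / y * ln t.
pose dk t := (ln_root_num t / t - ln_root_num y / y) / t.
have kdk t : 0 < t -> is_derive t 1 k (dk t).
  move=> t0; apply: (is_derive_eq (is_deriveB (is_derive_ln_root t t0)
    (is_deriveZ (ln_root_num y / y) (is_derive1_ln t0)))).
  rewrite /dk /GRing.scale/=; move: (ln_root_num t) (ln_root_num y) => A B.
  by field; rewrite !gt_eqF.
suff : k y < k x by rewrite /k; lra.
move: xy; rewrite neq_lt => /orP[xy|yx].
- have [c /andP[xc cy] e] := @MVT_pos R k dk x y kdk x0 xy.
  have c0 : 0 < c by lra.
  have : dk c < 0 by rewrite /dk pmulr_llt0 ?invr_gt0// subr_lt0 elasticity_incr.
  by move=> h; have : 0 < y - x; [lra|nra].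
- have [c /andP[yc cx] e] := @MVT_pos R k dk y x kdk y0 yx.
  have c0 : 0 < c by lra.
  have : 0 < dk c by rewrite /dk pmulr_lgt0 ?invr_gt0// subr_gt0 elasticity_incr.
  by move=> h; have : 0 < x - y; [lra|nra].
Qed.

End normalized_lnGamma.

(** * The inequalities in multiplicative form *)

Section exponential_form.
Context {R : realType}.
Implicit Types (a c x y : R).

Lemma Gamma_root a x : 0 < a -> 0 < x -> Gamma (x + a) `^ (1 / x) = expR (ln_root a x).
Proof.
move=> a0 x0; have g0 : 0 < Gamma (x + a) by apply: Gamma_gt0; lra.
by rewrite /powR gt_eqF// /ln_root /lnGamma mul1r mulrC.
Qed.

Lemma powR_div x y c : 0 < x -> 0 < y -> (x / y) `^ c = expR (c * (ln x - ln y)).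
Proof. by move=> x0 y0; rewrite /powR gt_eqF ?divr_gt0// ln_div ?posrE. Qed.

Lemma sqrt_expR x : Num.sqrt (expR x) = expR (x / 2).
Proof.
rewrite -[X in expR X](@divfK _ 2)// mulr_natr mulr2n expRD -expr2.
by rewrite sqrtr_sqr ger0_norm// expR_ge0.
Qed.

Definition midpoint_gap (f : R -> R) x y := f ((x + y) / 2) - (f x + f y) / 2.

Lemma midpoint_gap_diag f x : midpoint_gap f x x = 0.
Proof. by rewrite /midpoint_gap; have -> : (x + x) / 2 = x; [field|lra]. Qed.

Lemma Gamma_midpoint a x y : 0 < a -> 0 < x -> 0 < y ->
  (Gamma ((x + y) / 2 + a) `^ (2 / (x + y))) /
     Num.sqrt ((Gamma (x + a) `^ (1 / x)) * (Gamma (y + a) `^ (1 / y)))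
  = expR (midpoint_gap (ln_root a) x y).
Proof.
move=> a0 x0 y0; have m0 : 0 < (x + y) / 2 by lra.
have -> : 2 / (x + y) = 1 / ((x + y) / 2).
  by field; apply: lt0r_neq0; lra.
rewrite (Gamma_root a _ a0 m0) (Gamma_root a x a0 x0) (Gamma_root a y a0 y0).
by rewrite -expRD sqrt_expR -expRB.
Qed.

Lemma mean_ratio x y c : 0 < x -> 0 < y ->
  ((x + y) / (2 * Num.sqrt (x * y))) `^ c = expR (c * midpoint_gap (@ln R) x y).
Proof.
move=> x0 y0; have m0 : 0 < (x + y) / 2 by lra.
have -> : Num.sqrt (x * y) = expR ((ln x + ln y) / 2).
  by rewrite -sqrt_expR expRD !lnK.
rewrite invfM mulrA /powR gt_eqF ?(divr_gt0 m0) ?expR_gt0//.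
by rewrite ln_div ?posrE ?expR_gt0// expRK.
Qed.

Lemma ln_midpoint_gap_gt0 x y : 0 < x -> 0 < y -> x != y -> 0 < midpoint_gap (@ln R) x y.
Proof.
move=> x0 y0 xy.
suff : - ln ((x + y) / 2) < (- ln x + - ln y) / 2 by rewrite /midpoint_gap; lra.
apply: (midpoint_lt (fun x => - ln x) (fun x => - x^-1)) => //.
- by move=> t t0; apply: (is_deriveN (is_derive1_ln t0)).
- by move=> s t s0 st; rewrite ltrN2 ltf_pV2 ?posrE//; lra.
Qed.

(** The common shape of the equality cases: a strict inequality off the
    diagonal between functions that agree on it. *)
Lemma expR_le_eq_diag (lhs rhs : R -> R -> R) :
  (forall x, 0 < x -> lhs x x = rhs x x) ->
  (forall x y, 0 < x -> 0 < y -> x != y -> lhs x y < rhs x y) ->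
  forall x y, 0 < x -> 0 < y -> expR (lhs x y) <= expR (rhs x y) /\
    (expR (lhs x y) = expR (rhs x y) <-> x = y).
Proof.
move=> diag lt x y x0 y0; rewrite ler_expR.
have [<-|xy] := eqVneq x y; first by rewrite diag.
have h := lt x y x0 y0 xy; split; first exact: ltW.
split; last by move=> e; rewrite e eqxx in xy.
by move=> /expR_inj e; rewrite e ltxx in h.
Qed.

End exponential_form.

Local Close Scope classical_set_scope.

Theorem corollary2 (R : realType) (a c : R) (ha : 0 < a) :
  (* (1) *)
  (forall x y : R, 0 < x -> x < y ->
     let lhs := (Gamma (x + a) `^ (1 / x)) / (Gamma (y + a) `^ (1 / y)) in
     let rhs := (x / y) `^ c in
     (1 <= c -> (1 / 2 <= a /\ a <= 1) \/ 2 <= a -> lhs > rhs) /\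
     (c <= 0 -> a = 1 \/ a = 2 -> lhs < rhs)) /\
  (* (2) *)
  (forall x y : R, 0 < x -> 0 < y ->
     let lhs := (Gamma ((x + y) / 2 + a) `^ (2 / (x + y))) /
                Num.sqrt ((Gamma (x + a) `^ (1 / x)) *
                          (Gamma (y + a) `^ (1 / y))) in
     let rhs := ((x + y) / (2 * Num.sqrt (x * y))) `^ c in
     (2 <= a -> 1 <= c -> lhs <= rhs /\ (lhs = rhs <-> x = y)) /\
     (a = 2 -> c <= 0 -> lhs >= rhs /\ (lhs = rhs <-> x = y))) /\
  (* (3) *)
  ((1 / 2 <= a /\ a <= 1) \/ 2 <= a ->
   forall x y : R, 0 < x -> 0 < y ->
     let lower := (x / y) `^ ((y * digamma (y + a) - ln (Gamma (y + a))) / y) in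
     let mid := (Gamma (x + a) `^ (1 / x)) / (Gamma (y + a) `^ (1 / y)) in
     let upper := (x / y) `^ ((x * digamma (x + a) - ln (Gamma (x + a))) / x) in
     (lower <= mid /\ (lower = mid <-> x = y)) /\
     (mid <= upper /\ (mid = upper <-> x = y))).

Proof.
have range_ge0 : (1 / 2 <= a /\ a <= 1) \/ 2 <= a -> 2^-1 <= a /\ 0 <= lnGamma a.
  move=> h; split; first by case: h => [[]|]; lra.
  by apply: lnGamma_ge0 => //; case: h => [[_]|]; [left|right].
split; [|split].
- move=> x y x0 xy lhs rhs; have y0 : 0 < y by lra.
  have lnxy : ln x < ln y by rewrite ltr_ln.
  rewrite /lhs /rhs (Gamma_root a x ha x0) (Gamma_root a y ha y0) (powR_div _ _ _ x0 y0).
  rewrite -expRB !ltr_expR; split.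
    move=> c1 /range_ge0[a2 ga]; have := @ln_root_sub_ln_decr R a ha x y a2 ga x0 xy.
    nra.
  move=> c0 a12; have ga : lnGamma a = 0.
    by case: a12 => ->; [exact: lnGamma1|exact: lnGamma2].
  have := @ln_root_incr R a ha x y ga x0 xy; nra.
- move=> x y x0 y0 lhs rhs.
  rewrite /lhs /rhs Gamma_midpoint// mean_ratio//; split.
    move=> a2 c1; have [a12 ga] := range_ge0 (or_intror a2).
    apply: (expR_le_eq_diag (midpoint_gap (ln_root a))
      (fun x y => c * midpoint_gap (@ln R) x y)) => //.
      by move=> t _; rewrite !midpoint_gap_diag mulr0.
    move=> s t s0 t0 st.
    have := @ln_root_sub_ln_midpoint R a ha s t a12 ga s0 t0 st.
    have := ln_midpoint_gap_gt0 s t s0 t0 st; rewrite /midpoint_gap; nra.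
  move=> a2 c0; have ga : lnGamma a = 0 by rewrite a2 lnGamma2.
  have := expR_le_eq_diag (fun x y => c * midpoint_gap (@ln R) x y)
    (midpoint_gap (ln_root a)) _ _ x y x0 y0.
  case=> //.
  + by move=> t _; rewrite !midpoint_gap_diag mulr0.
  + move=> s t s0 t0 st.
    have := @ln_root_midpoint R a ha s t ga s0 t0 st.
    have := ln_midpoint_gap_gt0 s t s0 t0 st; rewrite /midpoint_gap; nra.
  + by move=> le e; split=> //; rewrite -e; split.
- move=> /range_ge0[a2 ga] x y x0 y0 lower mid upper.
  rewrite /lower /mid /upper (Gamma_root a x ha x0) (Gamma_root a y ha y0).
  rewrite !(powR_div _ _ _ x0 y0) -expRB; split.
    apply: (expR_le_eq_diag (fun x y => ln_root_num a y / y * (ln x - ln y))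
      (fun x y => ln_root a x - ln_root a y)) => //.
      by move=> t _; rewrite !subrr mulr0.
    by move=> s t s0 t0; exact: ln_root_tangent.
  apply: (expR_le_eq_diag (fun x y => ln_root a x - ln_root a y)
    (fun x y => ln_root_num a x / x * (ln x - ln y))) => //.
    by move=> t _; rewrite !subrr mulr0.
  move=> s t s0 t0; rewrite eq_sym => st.
  have := @ln_root_tangent R a ha t s a2 ga t0 s0 st; lra.
Qed.
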